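(* Let $(X,\mathbb{U})$ be a pre-Lindelöf uniform space with $|X|<\mathfrak{b}$. Then $(X,\mathbb{U})$ is ${\sf H}$-bounded.
   Context: A uniformity on a set $X$ is a nonempty family $\mathbb{U}$ of symmetric subsets of $X\times X$ containing the diagonal $\Delta=\{(x,x):x\in X\}$ (entourages) such that: (i) if $U\in\mathbb{U}$ and $V\supseteq U$ is a symmetric subset of $X\times X$, then $V\in\mathbb{U}$; (ii) $U,V\in\mathbb{U}$ implies $U\cap V\in\mathbb{U}$; (iii) for every $U\in\mathbb{U}$ there is $V\in\mathbb{U}$ with $V\circ V\subseteq U$; (iv) $\bigcap\mathbb{U}=\Delta$. The pair $(X,\mathbb{U})$ is a uniform space. For $U\in\mathbb{U}$, $x\in X$, $F\subseteq X$: $U[x]=\{y\in X:(x,y)\in U\}$ and $U[F]=\bigcup_{x\in F}U[x]$. $(X,\mathbb{U})$ is pre-Lindelöf if for each $U\in\mathbb{U}$ there is a countable $A\subseteq X$ with $U[A]=X$. $(X,\mathbb{U})$ is ${\sf H}$-bounded (Hurewicz-bounded) if for each sequence $(U_n)_{n\in\mathbb{N}}$ of members of $\mathbb{U}$ there is a sequence $(F_n)$ of finite subsets of $X$ such that each $x\in X$ belongs to $U_n[F_n]$ for all but finitely many $n$. For $f,g\in\mathbb{N}^{\mathbb{N}}$, $f\leq^*g$ means $f(n)\leq g(n)$ for all but finitely many $n$. A set $A\subseteq\mathbb{N}^{\mathbb{N}}$ is bounded if there is $g\in\mathbb{N}^{\mathbb{N}}$ with $f\leq^*g$ for all $f\in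 A$. $\mathfrak{b}$ is the minimum cardinality of an unbounded subset of $\mathbb{N}^{\mathbb{N}}$. *)

(* Defs.v *)
From HB Require Import structures.
From mathcomp Require Import all_boot all_order.
From mathcomp Require Import boolp classical_sets functions cardinality.
From mathcomp Require Import filter topology.

Set Implicit Arguments.
Unset Strict Implicit.
Unset Printing Implicit Defensive.

Local Open Scope classical_set_scope.
Local Open Scope card_scope.

(* In a [uniformType], [entourage] is the filter of all entourages. A uniformity
   in the convention where entourages are symmetric is recovered as the family
   of symmetric members of that filter; conversely it generates the filter. *)
Definition uniformity (X : uniformType) : set (set (X * X)) :=
  [set U | entourage U /\ (U^-1)%relation = U].

Arguments uniformity X : clear implicits.

(* [uniformType] does not include the separation axiom. *)
Definition separated_uniformity (X : uniformType) : Prop :=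
  \bigcap_(U in uniformity X) U = diagonal.

(* U[F] *)
Definition enlarge (X : Type) (U : set (X * X)) (F : set X) : set X :=
  \bigcup_(x in F) xsection U x.

Definition pre_Lindelof (X : uniformType) : Prop :=
  forall U : set (X * X), uniformity X U ->
    exists2 A : set X, countable A & enlarge U A = [set: X].

Arguments pre_Lindelof X : clear implicits.

Definition H_bounded (X : uniformType) : Prop :=
  forall U : nat -> set (X * X), (forall n, uniformity X (U n)) ->
    exists2 F : nat -> set X, (forall n, finite_set (F n)) &
      forall x : X, \forall n \near \oo, enlarge (U n) (F n) x.

Arguments H_bounded X : clear implicits.

Definition le_star (f g : nat -> nat) : Prop :=
  \forall n \near \oo, (f n <= g n)%N.

Definition star_bounded (A : set (nat -> nat)) : Prop :=
  exists g, forall f, A f -> le_star f g.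

Definition card_lt (T1 T2 : Type) (A : set T1) (B : set T2) : Prop :=
  (A #<= B) /\ ~ (B #<= A).

Lemma min_card (T : Type) (C : set (set T)) : C !=set0 ->
  exists B, C B /\ forall A, C A -> B #<= A.
Proof.
move=> [D CD]; have [C0|C0] := pselect (C set0).
  by exists set0; split => // A _; exact: card_le_emptyl.
have CN A : C A -> A !=set0.
  by move=> CA; apply/set0P/eqP => A0; apply: C0; rewrite -A0.
have [d _] := CN _ CD.
pose P := [set S : set (set T -> T) |
  (forall s A, S s -> C A -> A (s A)) /\
  (forall s t A, S s -> S t -> C A -> s A = t A -> s = t)].
have [F FP Ftot|S [[S1 S2] Smax]] := @Zorn_bigcup _ P.
  split=> [s A [X FX Xs] CA|s t A [X FX Xs] [Y FY Yt] CA].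
    by have [/(_ s A Xs CA)] := FP _ FX.
  have [XY|YX] := Ftot _ _ FX FY.
    by have [_ /(_ s t A (XY _ Xs) Yt CA)] := FP _ FY.
  by have [_ /(_ s t A Xs (YX _ Yt) CA)] := FP _ FX.
have [B [CB SB]] : exists B, C B /\ B `<=` (fun s => s B) @` S.
  apply: contrapT => noB.
  have ex A : exists a, C A -> A a /\ forall s, S s -> s A <> a.
    have [CA|nCA] := pselect (C A); last by exists d.
    apply: contrapT => H; apply: noB; exists A; split => // a Aa.
    apply: contrapT => na; apply: H; exists a => _; split => // s Ss sa.
    by apply: na; exists s.
  have [t tP] := choice ex.
  have St : ~ S t by move=> St; exact: (tP D CD).2 St erefl.
  apply: (Smax (S `|` [set t])).
    by split=> [|sub]; [exact: subsetUl|apply/St/sub; right].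
  split=> [s A [Ss|->] CA|s u A [Ss|->] [Su|->] CA //].
  - exact: (S1 s A).
  - exact: (tP A CA).1.
  - exact: (S2 s u A).
  - by move=> e; have := (tP A CA).2 s Ss.
  - by move=> e; have := (tP A CA).2 u Su (esym e).
exists B; split => // A CA.
apply: (card_le_trans (subset_card_le SB)).
apply: (card_le_trans (card_image_le _ _)).
have injA : {in S &, injective (fun s : set T -> T => s A)}.
  by move=> s t /set_mem Ss /set_mem St; exact: (S2 s t A).
have := inj_card_eq injA; rewrite card_eq_le => /andP[_] /card_le_trans; apply.
by apply: subset_card_le => _ [s Ss <-]; exact: (S1 s A).
Qed.

Lemma bounding_family_subproof : exists B : set (nat -> nat),
  ~ star_bounded B /\ forall A, ~ star_bounded A -> B #<= A.
Proof.
apply: (@min_card _ [set A | ~ star_bounded A]); exists setT => -[g gP].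
have [N _ /(_ N (leqnn N))] := gP (fun n => (g n).+1) I.
by rewrite /= ltnn.
Qed.

(* An unbounded family of minimum cardinality, so that the cardinal b is the
   cardinality of this set. *)
Definition bounding_family : set (nat -> nat) :=
  sval (cid bounding_family_subproof).

Lemma bounding_familyP : ~ star_bounded bounding_family /\
  forall A, ~ star_bounded A -> bounding_family #<= A.
Proof. exact: svalP (cid bounding_family_subproof). Qed.

(* Main.v *)
(** Enumerate, for each [n], a countable [A n] with [U n][[A n]] equal to the
    whole space, and send each point [x] to the function giving the index of an
    element of [A n] that is [U n]-close to [x]. There are fewer than b such
    functions, so some [g] dominates them all, and the elements of [A n] of
    index at most [g n] form the required finite sets. *)
Require Import Defs.
From mathcomp Require Import all_boot all_order.
From mathcomp Require Import boolp classical_sets functions cardinality.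
From mathcomp Require Import filter topology.

Local Open Scope classical_set_scope.

(** Were the range unbounded, minimality would embed [bounding_family] into it, hence into [T],
    contradicting the strict inequality. *)
Lemma star_bounded_range (T : Type) (f : T -> nat -> nat) :
  card_lt [set: T] bounding_family -> star_bounded (range f).
Proof.
move=> [_ ltTb]; apply: contrapT => unbounded; apply: ltTb.
apply: card_le_trans (bounding_familyP.2 _ unbounded) _.
exact: card_image_le.
Qed.

(** On this set [e] is injective with values below [m.+1], so finiteness pulls back from the
    image. *)
Lemma finite_index_le (T : Type) (A : set T) (e : T -> nat) (m : nat) :
  {in A &, injective e} -> finite_set [set a | A a /\ (e a <= m)%N].
Proof.
move=> injA; set F := [set a | _].
have injF : {in F &, injective e}.
  by move=> a b /set_mem[Aa _] /set_mem[Ab _]; apply: injA; exact: mem_set.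
rewrite -(eq_finite_set (inj_card_eq injF)).
apply: sub_finite_set (finite_II m.+1) => _ [a [_ le_em] <-].
by rewrite /= ltnS.
Qed.

Theorem theorem3p4 (X : uniformType) (sepX : separated_uniformity X)
  (LX : pre_Lindelof X) (ltXb : card_lt [set: X] bounding_family) :
  H_bounded X.
Proof.
move=> U uniU.
have /choice[A AP] n : exists A : set X,
    countable A /\ enlarge (U n) A = [set: X].
  by have [A] := LX _ (uniU n); exists A.
have /choice[e eP] n : exists e : X -> nat, {in A n &, injective e}.
  exact/countable_injP/(AP n).1.
have /choice[c cP] (x : X) : exists c : nat -> X,
    forall n, A n (c n) /\ xsection (U n) (c n) x.
  suff /choice[c cP] n : exists a, A n a /\ xsection (U n) a x by exists c.
  have : enlarge (U n) (A n) x by rewrite (AP n).2.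
  by move=> [a Aa Uax]; exists a.
have [g gP] := @star_bounded_range _ (fun x n => e n (c x n)) ltXb.
exists (fun n => [set a | A n a /\ (e n a <= g n)%N]) => [n|x].
  exact: finite_index_le (eP n).
(* Wherever [g] dominates the index function of [x], the chosen centre [c x n] itself lies in the
   finite set. *)
apply: filterS (gP _ (imageT _ x)) => n le_g.
by have [Ac Uc] := cP x n; exists (c x n).
Qed.
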